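(* Let $q$ be a prime power, let $e,f \ge 2$ be integers such that $ef = q-1$, let $\alpha$ be a generator of $\mathbb{F}_q^*$, and let $C=\{C_0,C_1,\dots,C_{e-1}\}$ with $C_i=\{\alpha^t : t\equiv i \pmod e\}$, which is a $(q,f,f-1)$ disjoint difference family in the additive group of $\mathbb{F}_q$. The block intersection numbers of the $2$-$(q,f,f-1)$ design $dev(C)$ are $0$ and the values of the cyclotomic numbers $(i,j)_e$ of order $e$ in $\mathbb{F}_q$. The intersection number $0$ has multiplicity $\frac{1}{2}q(q-1)n_e(0) + \frac{1}{2}qe(e-1)$, and each nonzero intersection number $N$ has multiplicity $\frac{1}{2}q(q-1)n_e(N)$.
   Context: The development of $C$ is the collection $dev(C)=\{C_i+g : 0\le i\le e-1,\ g\in\mathbb{F}_q\}$ of all translates; its members are the blocks of the design with point set $\mathbb{F}_q$. An integer $N$ is a block intersection number of a design if the design contains two distinct blocks $B,B'$ with $|B\cap B'|=N$; the multiplicity of $N$ is the number of unordered pairs of distinct blocks meeting in exactly $N$ points. For integers $0\le i,j\le e-1$, the cyclotomic number of order $e$ is $(i,j)_e=|(C_i+1)\cap C_j|$, where $C_i+1=\{c+1 : c\in C_i\}$. $n_e(N)$ denotes the number of pairs $(i,j)$ with $0\le i,j\le e-1$ such that $(i,j)_e=N$. *)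

(* Defs.v *)
From HB Require Import structures.
From mathcomp Require Import all_boot all_order all_fingroup all_algebra all_solvable all_field.

Set Implicit Arguments.
Unset Strict Implicit.
Unset Printing Implicit Defensive.

Import GRing.Theory.
Local Open Scope ring_scope.

Definition translate (G : finZmodType) (B : {set G}) (g : G) : {set G} :=
  [set b + g | b in B].

(* The development is a set of blocks, so repeated translates count once. For
   the cyclotomic family all translates C_i + g are in fact pairwise distinct,
   so the set and the multiset reading of dev(C) agree. *)
Definition dev (G : finZmodType) (C : {set {set G}}) : {set {set G}} :=
  [set translate B g | B in C, g in [set: G]].

(* [trivIset C] says that distinct members of C are disjoint. *)
Definition disjoint_difference_family (G : finZmodType) (v k l : nat)
    (C : {set {set G}}) : Prop :=
  [/\ #|G| = v,
      forall B, B \in C -> #|B| = k,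
      trivIset C
    & forall g : G, g != 0 ->
        (\sum_(B in C)
           #|[set xy : G * G |
                [&& xy.1 \in B, xy.2 \in B & (xy.1 - xy.2)%R == g]]|)%N = l].

Definition two_design (T : finType) (v k l : nat) (D : {set {set T}}) : Prop :=
  [/\ #|T| = v,
      forall B, B \in D -> #|B| = k
    & forall x y : T, x != y ->
        #|[set B in D | (x \in B) && (y \in B)]| = l].

Definition block_intersection_number (T : finType) (D : {set {set T}})
    (N : nat) : Prop :=
  exists B B' : {set T},
    [/\ B \in D, B' \in D, B != B' & #|B :&: B'| = N].

(* Unordered pairs of distinct blocks are the two-element subsets P of D. *)
Definition multiplicity (T : finType) (D : {set {set T}}) (N : nat) : nat :=
  #|[set P : {set {set T}} |
       [&& P \subset D, #|P| == 2 & #|\bigcap_(B in P) B| == N]]|.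

Section Cyclotomy.

Variables (F : finFieldType) (alpha : {unit F}) (e : nat).

(* The exponent t only ranges over 0 <= t < #[alpha]; when e divides the order
   of alpha this is the set of all alpha ^ t with t an integer congruent to i
   modulo e, see [cyclotomic_classP]. *)
Definition cyclotomic_class (i : nat) : {set F} :=
  [set val (alpha ^+ t)%g | t : 'I_#[alpha]%g & t == i %[mod e]].

Definition cyclotomic_family : {set {set F}} :=
  [set cyclotomic_class i | i : 'I_e].

Definition cyclotomic_number (i j : nat) : nat :=
  #|translate (cyclotomic_class i) 1 :&: cyclotomic_class j|.

Definition cyclotomic_count (N : nat) : nat :=
  #|[set ij : 'I_e * 'I_e | cyclotomic_number ij.1 ij.2 == N]|.

Lemma cyclotomic_classP (i : nat) (x : F) :
  (e %| #[alpha]%g)%N ->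
  (exists2 t : int, x = val alpha ^ t & (t = i %[mod e])%Z) <->
  x \in cyclotomic_class i.
Proof.
move=> edvd; have valX (n : nat) : val (alpha ^+ n)%g = val alpha ^+ n.
  by rewrite FinRing.val_unitX.
split=> [[t -> tE]|/imsetP[t]]; last first.
  by rewrite inE => /eqP tE ->; exists t%:Z; rewrite ?valX // !modz_nat tE.
set o := #[alpha]%g in edvd *.
have o_gt0 : (0 < o)%N := order_gt0 alpha.
have o_neq0 : o%:Z != 0 by rewrite eqz_nat -lt0n.
have r_ge0 : (0 <= (t %% o)%Z)%R by rewrite modz_ge0.
have [r rE] : exists r : nat, (t %% o)%Z = r%:Z.
  by exists `|(t %% o)%Z|%N; rewrite gez0_abs.
have r_lt : (r < o)%N by rewrite -ltz_nat -rE ltz_pmod.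
apply/imsetP; exists (Ordinal r_lt).
  rewrite inE /= -eqz_nat -!modz_nat -rE -tE [in X in _ == X](divz_eq t o%:Z).
  by have /dvdnP[m ->] := edvd; rewrite PoszM mulrA modzMDl.
have a_neq0 : val alpha != 0 by rewrite -unitfE; apply: (valP alpha).
rewrite /= valX {1}(divz_eq t o%:Z) rE expfzDr // [(t %/ _)%Z * _]mulrC.
have ao1 : val alpha ^ o%:Z = 1 by rewrite -exprnP -valX expg_order.
by rewrite -exprz_exp ao1 exp1rz mul1r.
Qed.

End Cyclotomy.

(* Main.v *)
Require Import Defs.
From HB Require Import structures.
From mathcomp Require Import all_boot all_order all_fingroup all_algebra all_solvable all_field.
From mathcomp Require Import ring.

Set Implicit Arguments.
Unset Strict Implicit.
Unset Printing Implicit Defensive.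

(** Since alpha generates the multiplicative group of F, every nonzero x is a
    power alpha ^ t, and it lies in C_i exactly when t = i mod e. All facts on
    the classes come from this exponent arithmetic: the C_i partition the
    nonzero elements, multiplication by alpha ^ n carries C_i onto C_(n + i),
    and two elements lie in a common class exactly when their ratio lies in
    C_0.

    Difference family and design. For g <> 0, a representation of g as a
    difference (y + g) - y inside some class is a nonzero y with
    (y + g) / y = 1 + g / y in C_0. The map y |-> 1 + g / y is a bijection onto
    C_0 minus 1, so there are f - 1 of them ([sum_class_differences]). The
    translates C_i + g containing two points x <> y correspond to the
    representations of x - y as such a difference, which gives the design.

    Distinctness of the blocks. C_i is invariant under multiplication by
    alpha ^ e, and alpha ^ e <> 1 because f >= 2, so the elements of C_i sum
    to 0. Those of C_i + g then sum to f g, and f is invertible in F since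
    e f = -1 there. Hence a block determines g, and then i ([block_inj]): dev(C)
    is faithfully indexed by the pairs (i, g).

    Intersections. Blocks C_i + g and C_j + g with i <> j are disjoint. If
    g <> h, the affine map z |-> (z - h) / (g - h) carries C_i + g and C_j + h
    onto C_(n + i) + 1 and C_(n + j), where alpha ^ n = (g - h)^-1, so they meet
    in a cyclotomic number ([card_meet_translates]). As (i, j) varies with g, h
    fixed, (n + i, n + j) runs once through all pairs. So among ordered pairs of
    distinct blocks, each of the q (q - 1) choices of g <> h contributes n_e(N)
    to the intersection number N, and each of the q choices of g = h
    contributes e (e - 1) to the number 0. Each unordered pair is counted
    twice ([card_ordered_pairs]). *)

Import GRing.Theory.
Local Open Scope ring_scope.

(** * Translates, and counting pairs of blocks *)

Lemma mem_translate (G : finZmodType) (B : {set G}) (g x : G) :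
  (x \in translate B g) = (x - g \in B).
Proof.
apply/imsetP/idP => [[b bB ->]|xB]; first by rewrite addrK.
by exists (x - g); rewrite ?subrK.
Qed.

(** Translation by 1 permutes R, so the sum of all elements is unchanged when
    1 is added to each of them. *)
Lemma card_natr_eq0 (R : finNzRingType) : #|R|%:R = 0 :> R.
Proof.
have : \sum_(x : R) (x + 1) = \sum_(x : R) x.
  by rewrite [RHS](reindex_inj (addIr 1)).
by rewrite big_split /= sumr_const -[RHS]addr0 => /addrI.
Qed.

(** The map (u, v) |-> {b u, b v} is two-to-one onto the pairs counted by
    [multiplicity]. This transfers the count from sets of blocks to their
    indices, where it can be computed coordinatewise. *)
Lemma card_ordered_pairs (I T : finType) (b : I -> {set T}) (N : nat) :
  injective b ->
  #|[set uv : I * I | (uv.1 != uv.2) && (#|b uv.1 :&: b uv.2| == N)]|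
    = (2 * multiplicity [set b u | u : I] N)%N.
Proof.
move=> b_inj; set A := [set uv : I * I | _].
set D := [set b u | u : I].
pose U (uv : I * I) : {set {set T}} := [set b uv.1; b uv.2].
have big2 (u v : I) : u != v -> \bigcap_(B in U (u, v)) B = b u :&: b v.
  by move=> uv; rewrite /U /= big_setU1 ?big_set1 // inE (inj_eq b_inj).
rewrite /multiplicity; set M := [set P : {set {set T}} | _].
rewrite -sum1_card (partition_big U [in M]) /=; last first.
  case=> u v; rewrite !inE /= => /andP[uv cN].
  rewrite cards2 (inj_eq b_inj) uv eqxx -/(U (u, v)) big2 // cN !andbT.
  by apply/subsetP => B; rewrite !inE => /orP[] /eqP ->; apply: imset_f.
rewrite mulnC -sum_nat_const; apply: eq_bigr => P.
rewrite inE => /and3P[PD /cards2P[B [B' [BB' PE]]] cN].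
have /imsetP[u _ Bu] : B \in D by apply: (subsetP PD); rewrite PE !inE eqxx.
have /imsetP[v _ Bv] : B' \in D.
  by apply: (subsetP PD); rewrite PE !inE eqxx orbT.
have uv : u != v by rewrite -(inj_eq b_inj) -Bu -Bv.
have cuv : #|b u :&: b v| == N by rewrite -big2 // /U /= -Bu -Bv -PE.
(* The fibre over {b u, b v} consists of the two orderings. *)
rewrite sum1dep_card; transitivity #|[set (u, v); (v, u)]|; last first.
  by rewrite cards2 xpair_eqE (negPf uv).
apply: eq_card => -[x y]; rewrite !inE /= !xpair_eqE PE Bu Bv.
apply/andP/orP => [[/andP[xy _] /eqP E]|].
  have: b x \in U (x, y) by rewrite !inE eqxx.
  have: b y \in U (x, y) by rewrite !inE eqxx orbT.
  rewrite E !inE !(inj_eq b_inj) => /orP[] /eqP yE /orP[] /eqP xE;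
    by rewrite xE yE ?eqxx in xy *; auto.
case=> /andP[/eqP -> /eqP ->]; first by rewrite uv cuv.
by rewrite eq_sym uv setIC cuv /U /= setUC.
Qed.

(** * Cyclotomic classes *)

Section CyclotomicClasses.

Variables (F : finFieldType) (alpha : {unit F}) (e f : nat).
Hypothesis alpha_gen : generator [set: {unit F}] alpha.
Hypothesis e_gt0 : (0 < e)%N.
Hypothesis ef : (e * f)%N = #|F|.-1.

Local Notation cyc := (cyclotomic_class alpha e).
Local Notation a := (val alpha).

Lemma order_alpha : #[alpha]%g = (e * f)%N.
Proof. by rewrite /order -(eqP alpha_gen) card_finField_unit ef. Qed.

(** Reducing the exponent modulo the order of alpha does not change its residue
    modulo e, because e divides that order. *)
Lemma mem_cyclotomic_classX t i : (a ^+ t \in cyc i) = (t == i %[mod e]).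
Proof.
have e_dvd : (e %| #[alpha]%g)%N by rewrite order_alpha dvdn_mulr.
rewrite -FinRing.val_unitX; apply/imsetP/idP.
  case=> s; rewrite inE => si /val_inj/eqP; rewrite eq_expg_mod_order => /eqP ts.
  by rewrite -(modn_dvdm t e_dvd) ts modn_dvdm.
move=> ti; exists (Ordinal (ltn_pmod t (order_gt0 alpha))) => /=.
  by rewrite inE /= modn_dvdm.
by rewrite expg_mod_order.
Qed.

Lemma alpha_neq0 : a != 0.
Proof. by rewrite -unitfE (valP alpha). Qed.

Lemma nonzero_powP (x : F) : x != 0 -> exists t, x = a ^+ t.
Proof.
rewrite -unitfE => ux.
have : FinRing.unit F ux \in [set: {unit F}] by rewrite inE.
rewrite (eqP alpha_gen) => /cycleP[t xt]; exists t.
by rewrite -FinRing.val_unitX -xt.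
Qed.

Lemma zero_notin_class i : (0 \in cyc i) = false.
Proof.
apply/negP => /imsetP[t _ /eqP]; rewrite FinRing.val_unitX eq_sym.
by rewrite expf_eq0 (negPf alpha_neq0) andbF.
Qed.

Lemma class_neq0 i x : x \in cyc i -> x != 0.
Proof. by apply: contraTneq => ->; rewrite zero_notin_class. Qed.

Lemma eq_class_mod i j : i = j %[mod e] -> cyc i = cyc j.
Proof.
move=> ij; apply/setP => x; have [->|/nonzero_powP[t ->]] := eqVneq x 0.
  by rewrite !zero_notin_class.
by rewrite !mem_cyclotomic_classX ij.
Qed.

Lemma class_inj (i j : 'I_e) x : x \in cyc i -> x \in cyc j -> i = j.
Proof.
move=> xi; have [t E] := nonzero_powP (class_neq0 xi).
move: xi; rewrite E !mem_cyclotomic_classX => /eqP -> /eqP.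
by rewrite !modn_small // => /val_inj.
Qed.

Lemma class_cover x : x != 0 -> exists i : 'I_e, x \in cyc i.
Proof.
move=> /nonzero_powP[t ->]; exists (Ordinal (ltn_pmod t e_gt0)).
by rewrite mem_cyclotomic_classX /= modn_mod.
Qed.

Lemma mem_class_scale n i x : (a ^+ n * x \in cyc (n + i)) = (x \in cyc i).
Proof.
have [->|/nonzero_powP[t ->]] := eqVneq x 0.
  by rewrite mulr0 !zero_notin_class.
by rewrite -exprD !mem_cyclotomic_classX eqn_modDl.
Qed.

Lemma mem_class_ratio i x y : y \in cyc i -> (x \in cyc i) = (x / y \in cyc 0).
Proof.
move=> yi; have y0 := class_neq0 yi; have [n yE] := nonzero_powP y0.
have ni : n = i %[mod e] by apply/eqP; rewrite -mem_cyclotomic_classX -yE.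
by rewrite -[RHS](mem_class_scale n) addn0 -yE mulrCA divff // mulr1 (eq_class_mod ni).
Qed.

(** Any count over the nonzero elements can be split along the partition into
    classes: with P always true this gives the size of a class, and with P a
    condition on a ratio it gives the number of differences. *)
Lemma sum_card_class (P : pred F) :
  (\sum_(i < e) #|[set x in cyc i | P x]| = #|[set x | (x != 0%R) && P x]|)%N.
Proof.
under eq_bigr => i _ do rewrite -sum1dep_card big_mkcond.
rewrite exchange_big -sum1dep_card [RHS]big_mkcond /=; apply: eq_bigr => x _.
have [->|x0] := eqVneq x 0.
  by rewrite big1 // => i _; rewrite zero_notin_class.
have [i xi] := class_cover x0.
rewrite (bigD1 i) //= xi big1 ?addn0 // => j ji.
by case: ifP => // /andP[xj _]; rewrite (class_inj xi xj) eqxx in ji.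
Qed.

(** Scaling makes all e classes equinumerous, and together they have e f
    elements. *)
Lemma card_class i : #|cyc i| = f.
Proof.
have scale n : #|cyc n| = #|cyc 0|.
  rewrite -(card_preimset (cyc n) (mulfI (expf_neq0 n alpha_neq0))).
  by apply: eq_card => x; rewrite inE -[in cyc n](addn0 n) mem_class_scale.
have /eqP := sum_card_class predT.
have -> : #|[set x : F | (x != 0) && predT x]| = (e * f)%N.
  by rewrite ef -(cardC1 (0 : F)); apply: eq_card => x; rewrite !inE andbT.
under eq_bigr => j _.
  rewrite (_ : [set x in cyc j | predT x] = cyc j); last first.
    by apply/setP => x; rewrite !inE andbT.
  rewrite scale; over.
by rewrite sum_nat_const card_ord eqn_pmul2l // -(scale i) => /eqP.
Qed.

Lemma one_in_class0 : 1 \in cyc 0.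
Proof. by rewrite -[1]/(a ^+ 0) mem_cyclotomic_classX. Qed.

(** The condition that y and y + g lie in a common class reads
    1 + g / y \in C_0, and y |-> 1 + g / y is injective with inverse
    c |-> g / (c - 1). The value c = 1 is the one not attained. *)
Lemma sum_class_differences (g : F) : g != 0 ->
  (\sum_(i < e) #|[set y in cyc i | (y + g)%R \in cyc i]| = f - 1)%N.
Proof.
move=> g0.
transitivity (\sum_(i < e) #|[set y in cyc i | ((y + g) / y)%R \in cyc 0]|)%N.
  apply: eq_bigr => i _; apply: eq_card => y; rewrite !inE.
  by case: (boolP (y \in cyc i)) => //= yi; rewrite (mem_class_ratio _ yi).
rewrite sum_card_class -[in RHS](card_class 0).
rewrite [#|cyc 0|](cardsD1 1) one_in_class0 add1n subn1 /=.
have inj : {in cyc 0 :\ 1 &, injective (fun c => g / (c - 1))}.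
  by move=> c d _ _ /(mulfI g0)/invr_inj/addIr.
rewrite -(card_in_imset inj); apply: eq_card => y; rewrite inE.
apply/andP/imsetP => [[y0 yc]|[c]].
  exists ((y + g) / y); last first.
    by rewrite mulrDl divff // [1 + _]addrC addrK invf_div mulrCA divff ?mulr1.
  rewrite !inE yc andbT mulrDl divff // -subr_eq0 [1 + _]addrC addrK.
  by rewrite mulf_neq0 ?invr_neq0.
rewrite !inE => /andP[c1 c0] ->; have c10 : c - 1 != 0 by rewrite subr_eq0.
rewrite mulf_neq0 ?invr_neq0 // (_ : _ / _ = c) //.
by field; apply/andP.
Qed.

(** * Intersections of translates of classes *)

Definition shift n (i : 'I_e) : 'I_e := Ordinal (ltn_pmod (n + i) e_gt0).

Lemma shift_inj n : injective (shift n).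
Proof.
move=> i j /(congr1 val)/eqP /=.
by rewrite eqn_modDl !modn_small // => /eqP/val_inj.
Qed.

Lemma class_shift n (i : 'I_e) : cyc (shift n i) = cyc (n + i).
Proof. by apply: eq_class_mod; rewrite /= modn_mod. Qed.

(** The affine bijection z |-> (z - h) / (g - h) sends g to 1 and h to 0, and
    it multiplies differences by a power of alpha. The exponent n depends on g
    and h only, which makes the count over (i, j) uniform. *)
Lemma card_meet_translates (g h : F) : g != h -> exists n, forall i j : 'I_e,
  #|translate (cyc i) g :&: translate (cyc j) h|
    = cyclotomic_number alpha e (shift n i) (shift n j).
Proof.
rewrite -subr_eq0 => gh; have [n nE] := nonzero_powP (invr_neq0 gh).
exists n => i j; have d0 : a ^+ n != 0 by rewrite -nE invr_neq0.
have inj : injective (fun z => a ^+ n * (z - h)) by move=> x y /(mulfI d0)/addIr.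
rewrite /cyclotomic_number !class_shift -[RHS](card_preimset _ inj).
apply: eq_card => z; rewrite !inE !mem_translate.
rewrite (_ : _ * _ - 1 = a ^+ n * (z - g)) ?mem_class_scale //.
by rewrite -nE; field.
Qed.

Lemma cyclotomic_count_shift n N :
  #|[set ij : 'I_e * 'I_e
      | cyclotomic_number alpha e (shift n ij.1) (shift n ij.2) == N]|
    = cyclotomic_count alpha e N.
Proof.
pose s (ij : 'I_e * 'I_e) := (shift n ij.1, shift n ij.2).
have s_inj : injective s.
  move=> [i j] [i' j'] /eqP; rewrite xpair_eqE !(inj_eq (@shift_inj n)).
  by rewrite -xpair_eqE => /eqP.
rewrite /cyclotomic_count -[RHS](card_preimset _ s_inj).
by apply: eq_card => ij; rewrite !inE.
Qed.

(** * Distinctness of the blocks *)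

Hypothesis f_ge2 : (2 <= f)%N.

(** Multiplication by alpha ^ e permutes the class and multiplies its sum by
    alpha ^ e, which differs from 1 because f >= 2. *)
Lemma sum_class i : \sum_(x in cyc i) x = 0.
Proof.
have ae1 : a ^+ e != 1.
  rewrite -FinRing.val_unitX -[1]/(val (1%g : {unit F})) (inj_eq val_inj).
  by rewrite -order_dvdn order_alpha gtnNdvd // -[X in (X < _)%N]muln1 ltn_pmul2l.
have E : \sum_(x in cyc i) x = a ^+ e * \sum_(x in cyc i) x.
  rewrite mulr_sumr (reindex_inj (mulfI (expf_neq0 e alpha_neq0))) /=.
  apply: eq_bigl => x; rewrite -[RHS](mem_class_scale e).
  by rewrite (eq_class_mod (modnDl i e)).
apply/eqP; move/eqP: E; rewrite -subr_eq0 -{1}[X in X - _]mul1r -mulrBl mulf_eq0.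
by rewrite subr_eq0 eq_sym (negPf ae1).
Qed.

(** In F we have e f = q - 1 = -1. *)
Lemma natr_f_neq0 : f%:R != 0 :> F.
Proof.
apply: contra_eq_neq (card_natr_eq0 F) => f0.
have -> : #|F| = (e * f).+1 by rewrite ef prednK // (cardD1 0).
by rewrite -natr1 natrM f0 mulr0 add0r oner_neq0.
Qed.

Definition block (u : 'I_e * F) : {set F} := translate (cyc u.1) u.2.

Lemma sum_block u : \sum_(x in block u) x = u.2 *+ f.
Proof.
rewrite /block /translate big_imset /=; last by move=> x y _ _ /addIr.
by rewrite big_split /= sum_class add0r sumr_const card_class.
Qed.

(** The sum of the elements of a block recovers the translation g, and a single
    element of C_i then recovers i. *)
Lemma block_inj : injective block.
Proof.
case=> i g [j h] E; have := sum_block (i, g); rewrite E sum_block /=.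
rewrite -mulr_natr -[RHS]mulr_natr => /(mulIf natr_f_neq0) /= gh.
subst g.
have [|x xi] := card_gt0P (_ : 0 < #|cyc i|)%N; first by rewrite card_class ltnW.
have : x + h \in block (i, h) by rewrite mem_translate addrK.
by rewrite E mem_translate addrK => xj; rewrite (class_inj xi xj).
Qed.

Lemma classes_inj : injective (fun i : 'I_e => cyc i).
Proof.
move=> i j E; have : block (i, 0) = block (j, 0) by rewrite /block /= E.
by move=> /block_inj[].
Qed.

Lemma dev_blocks : dev (cyclotomic_family alpha e) = [set block u | u : 'I_e * F].
Proof.
apply/setP => B; apply/imset2P/imsetP => [[_ g /imsetP[i _ ->] _ ->]|[[i g] _ ->]].
  by exists (i, g).
by exists (cyc i) g; rewrite ?imset_f.
Qed.

Lemma block_disjoint (i j : 'I_e) g :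
  i != j -> block (i, g) :&: block (j, g) = set0.
Proof.
move=> ij; apply/setP => x; rewrite !inE !mem_translate /=.
by apply: contra_neqF ij => /andP[xi /(class_inj xi)].
Qed.

(** * The design and its intersection numbers *)

Lemma cyclotomic_ddf :
  disjoint_difference_family #|F| f (f - 1) (cyclotomic_family alpha e).
Proof.
split=> //.
- by move=> _ /imsetP[i _ ->]; apply: card_class.
- apply/trivIsetP => _ _ /imsetP[i _ ->] /imsetP[j _ ->] ij.
  rewrite -setI_eq0; apply/eqP/setP => x; rewrite !inE.
  by apply: contra_neqF ij => /andP[xi /(class_inj xi) ->].
move=> g g0; rewrite -(sum_class_differences g0) big_imset /=; last first.
  by move=> i j _ _; apply: classes_inj.
apply: eq_bigr => i _.
have inj : injective (fun y : F => (y + g, y)) by move=> x y [].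
rewrite -(card_imset _ inj); apply: eq_card => -[x y]; rewrite inE /=.
apply/and3P/imsetP => [[xi yi /eqP <-]|[z]].
  by exists y; rewrite ?inE addrC subrK ?yi.
by rewrite inE => /andP[zi zgi] [-> ->]; rewrite zi zgi [z + g]addrC addrK.
Qed.

(** A block C_i + g through x and y corresponds to the pair (x - g, y - g) in
    C_i, whose difference is x - y, and g is recovered from that pair. *)
Lemma cyclotomic_two_design :
  two_design #|F| f (f - 1) (dev (cyclotomic_family alpha e)).
Proof.
rewrite dev_blocks; split=> //.
  move=> _ /imsetP[u _ ->].
  by rewrite /block /translate card_imset ?card_class //; apply: addIr.
move=> x y xy; have d0 : x - y != 0 by rewrite subr_eq0.
transitivity #|[set u | (x \in block u) && (y \in block u)]|.
  rewrite -[RHS](card_imset _ block_inj); apply: eq_card => B; rewrite !inE.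
  apply/andP/imsetP => [[/imsetP[u _ ->] xyu]|[u]]; first by exists u; rewrite ?inE.
  by rewrite inE => xyu ->; rewrite imset_f.
rewrite -(sum_class_differences d0) -sum1dep_card big_mkcond /=.
rewrite -(pair_bigA _ (fun i g =>
  if (x \in block (i, g)) && (y \in block (i, g)) then 1 else 0)%N) /=.
apply: eq_bigr => i _; rewrite -big_mkcond sum1dep_card.
have inj : injective (fun g : F => y - g) by move=> g h /addrI/oppr_inj.
rewrite -[RHS](card_preimset _ inj); apply: eq_card => g.
rewrite !inE !mem_translate /= andbC (_ : y - g + (x - y) = x - g) //.
by ring.
Qed.

(** The number (i, j)_e is attained by C_i + 1 and C_j, which are distinct
    blocks even for i = j; since e >= 2, the number 0 is attained by the
    disjoint blocks C_0 and C_1. *)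
Lemma cyclotomic_intersection_numbers (e_ge2 : (2 <= e)%N) N :
  block_intersection_number (dev (cyclotomic_family alpha e)) N <->
  N = 0%N \/ exists i j : 'I_e, cyclotomic_number alpha e i j = N.
Proof.
rewrite dev_blocks; split.
  move=> [_ [_ [/imsetP[[i g] _ ->] /imsetP[[j h] _ ->] neq <-]]].
  have [E|/card_meet_translates[n nE]] := eqVneq g h.
    left; rewrite -E block_disjoint ?cards0 //.
    by apply: contraNneq neq => ->; rewrite E.
  by right; exists (shift n i), (shift n j); rewrite -nE.
case=> [->|[i [j <-]]].
  pose i0 : 'I_e := Ordinal e_gt0; pose i1 : 'I_e := Ordinal e_ge2.
  exists (block (i0, 0)), (block (i1, 0)); rewrite !imset_f //.
  by rewrite (inj_eq block_inj) block_disjoint ?cards0.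
exists (block (i, 1)), (block (j, 0)); rewrite !imset_f //.
rewrite (inj_eq block_inj) xpair_eqE oner_eq0 andbF; split=> //.
by congr #|_ :&: _|; apply/setP => x; rewrite mem_translate subr0.
Qed.

Lemma card_equal_translates g N :
  #|[set ij : 'I_e * 'I_e | ((ij.1, g) != (ij.2, g))
      && (#|block (ij.1, g) :&: block (ij.2, g)| == N)]|
    = ((N == 0) * (e * (e - 1)))%N.
Proof.
transitivity #|[set ij : 'I_e * 'I_e | (ij.1 != ij.2) && (N == 0%N)]|.
  apply: eq_card => -[i j]; rewrite !inE /= xpair_eqE eqxx andbT.
  by case: (eqVneq i j) => //= ij; rewrite block_disjoint // cards0 eq_sym.
case: (N == 0%N); last first.
  by rewrite mul0n; apply: eq_card0 => ij; rewrite !inE andbF.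
rewrite mul1n -sum1dep_card big_mkcond /=.
rewrite -(pair_bigA _ (fun i j => if (i != j) && true then 1 else 0)%N) /=.
transitivity (\sum_(i < e) (e - 1))%N; last by rewrite sum_nat_const card_ord.
apply: eq_bigr => i _; rewrite -big_mkcond sum1dep_card subn1.
rewrite -[in RHS](card_ord e) -(cardC1 i); apply: eq_card => j.
by rewrite !inE andbT eq_sym.
Qed.

(** Grouping the pairs ((i, g), (j, h)) by (g, h): the diagonal g = h has q
    terms, and off the diagonal each of the q (q - 1) terms is the same number,
    by [card_meet_translates] and [cyclotomic_count_shift]. *)
Lemma card_ordered_block_pairs N :
  #|[set uv : ('I_e * F) * ('I_e * F) |
      (uv.1 != uv.2) && (#|block uv.1 :&: block uv.2| == N)]|
  = (#|F| * (#|F| - 1) * cyclotomic_count alpha e N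
     + (N == 0) * (#|F| * e * (e - 1)))%N.
Proof.
pose tr (p : (F * F) * ('I_e * 'I_e)) := ((p.2.1, p.1.1), (p.2.2, p.1.2)).
have tr_bij : bijective tr.
  by exists (fun uv => ((uv.1.2, uv.2.2), (uv.1.1, uv.2.1))); case=> -[? ?] [].
rewrite -sum1dep_card (reindex tr) /=; last exact: onW_bij.
rewrite big_mkcond /=.
pose G (gh : F * F) (ij : 'I_e * 'I_e) : nat :=
  if ((ij.1, gh.1) != (ij.2, gh.2))
     && (#|block (ij.1, gh.1) :&: block (ij.2, gh.2)| == N) then 1%N else 0%N.
rewrite -(pair_bigA _ G) /=.
transitivity (\sum_(gh : F * F) if gh.1 == gh.2 then (N == 0) * (e * (e - 1))
                else cyclotomic_count alpha e N)%N.
  apply: eq_bigr => -[g h] _; rewrite /G -big_mkcond sum1dep_card /=.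
  have [<-|gh] := eqVneq g h; first exact: card_equal_translates.
  have [n nE] := card_meet_translates gh.
  rewrite -(cyclotomic_count_shift n); apply: eq_card => ij; rewrite !inE -nE.
  by rewrite xpair_eqE (negPf gh) andbF.
rewrite -(pair_bigA _ (fun g h : F => if g == h then (N == 0) * (e * (e - 1))
                else cyclotomic_count alpha e N)%N) /=.
transitivity (\sum_(g : F) ((N == 0) * (e * (e - 1)) +
                 (#|F| - 1) * cyclotomic_count alpha e N))%N.
  apply: eq_bigr => g _; rewrite (bigD1 g) //= eqxx; congr (_ + _)%N.
  rewrite [in RHS]subn1 -(cardC1 g) -sum_nat_const; apply: eq_bigr => h.
  by rewrite eq_sym => /negPf ->.
by rewrite sum_nat_const; ring.
Qed.

Lemma cyclotomic_multiplicity N :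
  (2 * multiplicity (dev (cyclotomic_family alpha e)) N)%N
  = (#|F| * (#|F| - 1) * cyclotomic_count alpha e N
     + (N == 0) * (#|F| * e * (e - 1)))%N.
Proof.
rewrite dev_blocks -(card_ordered_pairs _ block_inj).
exact: card_ordered_block_pairs.
Qed.

End CyclotomicClasses.

Theorem proposition4p1
    (p k q : nat) (p_prime : prime p) (k_gt0 : (0 < k)%N) (q_def : q = (p ^ k)%N)
    (F : finFieldType) (cardF : #|F| = q)
    (e f : nat) (e_ge2 : (2 <= e)%N) (f_ge2 : (2 <= f)%N)
    (ef : (e * f)%N = (q - 1)%N)
    (alpha : {unit F}) (alpha_gen : generator [set: {unit F}] alpha) :
  let C := cyclotomic_family alpha e in
  [/\ disjoint_difference_family q f (f - 1) C,
      two_design q f (f - 1) (dev C),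
      forall N : nat,
        block_intersection_number (dev C) N <->
        N = 0%N \/ exists i j : 'I_e, cyclotomic_number alpha e i j = N,
      (multiplicity (dev C) 0)%:R =
        2^-1 * q%:R * (q%:R - 1) * (cyclotomic_count alpha e 0)%:R
        + 2^-1 * q%:R * e%:R * (e%:R - 1) :> rat
    & forall N : nat, N <> 0%N -> block_intersection_number (dev C) N ->
        (multiplicity (dev C) N)%:R =
          2^-1 * q%:R * (q%:R - 1) * (cyclotomic_count alpha e N)%:R :> rat].
Proof.
move=> C; have e_gt0 := ltnW e_ge2.
have efF : (e * f)%N = #|F|.-1 by rewrite cardF -subn1.
have q_gt0 : (0 < q)%N by rewrite -cardF (cardD1 0).
have mult N : 2 * (multiplicity (dev C) N)%:R
    = q%:R * (q%:R - 1) * (cyclotomic_count alpha e N)%:R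
      + (N == 0%N)%:R * (q%:R * e%:R * (e%:R - 1)) :> rat.
  have := cyclotomic_multiplicity alpha_gen e_gt0 efF f_ge2 N.
  by rewrite cardF => /(congr1 (fun n => n%:R : rat)); rewrite natrD !natrM !natrB.
split; rewrite -?cardF.
- exact: cyclotomic_ddf.
- exact: cyclotomic_two_design.
- exact: (cyclotomic_intersection_numbers alpha_gen e_gt0 efF f_ge2 e_ge2).
- by apply: (mulfI (_ : 2 != 0)) => //; rewrite mult cardF eqxx /=; field.
- move=> N N_neq0 _; have /negPf N0 : N != 0%N by apply/eqP.
  by apply: (mulfI (_ : 2 != 0)) => //; rewrite mult cardF N0 /=; field.
Qed.
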